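(* Let the weight $w$ on $\mathbb N_0$ satisfy the discrete Pearson equation $\theta(k+1)w(k+1)=\sigma(k)w(k)$, $k\in\mathbb N_0$, with $\theta,\sigma$ polynomials and $\theta(0)=0$. Then the Laguerre--Freud structure matrix $\Psi=\Pi^{-1}H\theta(J^\top)=\sigma(J)H\Pi^\top$ and the Jacobi matrix $J$ fulfill $$\sigma(J)\theta(J+I)=\Psi H^{-1}\Psi^\top H^{-1},\qquad \theta(J)\sigma(J-I)=\Psi^\top H^{-1}\Psi H^{-1}.$$
   Context: $\mathbb N_0=\{0,1,2,\dots\}$; all matrices are semi-infinite, indexed by $\mathbb N_0$. The moments $\rho_n=\sum_{k=0}^\infty k^nw(k)$ are assumed (absolutely) convergent, and all leading principal minors of the moment matrix $G=(\rho_{n+m})_{n,m\in\mathbb N_0}$ are assumed nonzero, so that $G=S^{-1}HS^{-\top}$ uniquely with $S$ lower unitriangular and $H=\operatorname{diag}(H_0,H_1,\dots)$, $H_n\neq0$. $\Lambda$ is the shift matrix with ones on the first superdiagonal and zeros elsewhere; $J=S\Lambda S^{-1}$ is the Jacobi matrix (tridiagonal). $B$ is the lower Pascal matrix, $B_{n,m}=\binom nm$ for $n\ge m$, $0$ otherwise, and $\Pi=SBS^{-1}$. The two expressions for $\Psi$ coincide and $\Psi$ is banded. *)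

(* Defs.v *)
From HB Require Import structures.
From mathcomp Require Import all_boot all_order all_algebra.
From mathcomp Require Import complex.
From mathcomp Require Import all_classical all_reals all_analysis.

Set Implicit Arguments.
Unset Strict Implicit.
Unset Printing Implicit Defensive.

Import Order.TTheory GRing.Theory Num.Theory.
Import numFieldNormedType.Exports.

Local Open Scope classical_set_scope.
Local Open Scope ring_scope.

(** Semi-infinite matrices, indexed by nat * nat. Sums and differences are
    pointwise, through the canonical Z-module structure on functions. *)
Notation smx K := (nat -> nat -> K).

Declare Scope smx_scope.
Delimit Scope smx_scope with SM.

Section SemiInfiniteMatrices.
Variable K : fieldType.
Implicit Types (A B S : smx K) (h : nat -> K) (p : {poly K}).

(** The product is purely algebraic: the entry (n, m) is the finitely supported
    sum of the A n k * B k m, so it is meaningful when only finitely many of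
    these terms are nonzero (the library convention gives 0 otherwise). This is
    always so when A has finitely supported rows, or B finitely supported
    columns, e.g. when A is lower triangular or banded. *)
Definition smx_mul A B : smx K :=
  fun n m => \sum_(k \in [set: nat]) (A n k * B k m).

Definition smx_tr A : smx K := fun n m => A m n.

Definition smx_diag h : smx K := fun n m => if n == m then h n else 0.

Definition smx_id : smx K := smx_diag (fun=> 1).

(** The two-sided inverse, or A itself if there is none. It is used below only
    for lower unitriangular matrices and for diagonal matrices with nonzero
    diagonal entries; these have exactly one inverse among all matrices. *)
Definition smx_inv A : smx K :=
  xget A [set X | smx_mul A X = smx_id /\ smx_mul X A = smx_id].

Definition smx_pow A (i : nat) : smx K := iter i (smx_mul A) smx_id.

Definition smx_horner p A : smx K :=
  fun n m => \sum_(i < size p) p`_i * smx_pow A i n m.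

Definition lower_unitriangular S : Prop :=
  (forall n, S n n = 1) /\ (forall n m, (n < m)%N -> S n m = 0).

Definition smx_shift : smx K := fun n m => (m == n.+1)%:R.

(** The binomial coefficient 'C(n, m) vanishes for n < m. *)
Definition pascal : smx K := fun n m => 'C(n, m)%:R.

Definition leading_minor A (n : nat) : K := \det (\matrix_(i < n, j < n) A i j).

End SemiInfiniteMatrices.

Arguments smx_id {K}.
Arguments smx_shift {K}.
Arguments pascal {K}.
Arguments smx_mul {K} (A B)%_SM.
Arguments smx_tr {K} A%_SM.
Arguments smx_inv {K} A%_SM.
Arguments smx_horner {K} p A%_SM.

Notation "A *m B" := (smx_mul A B) : smx_scope.
Notation "A ^T" := (smx_tr A) : smx_scope.
Notation "A ^-1" := (smx_inv A) : smx_scope.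
Notation "p .[ A ]" := (smx_horner p A) : smx_scope.

Section Structures.
Variable K : fieldType.
Local Open Scope smx_scope.
Implicit Types (G S : smx K) (h : nat -> K).

(** G = S^-1 H S^-T with S lower unitriangular and H = diag(h_0, h_1, ...). *)
Definition cholesky G S h : Prop :=
  [/\ lower_unitriangular S, forall n, h n != 0
    & G = S^-1 *m smx_diag h *m S^-1^T].

Definition jacobi S : smx K := S *m smx_shift *m S^-1.

Definition dressed_pascal S : smx K := S *m pascal *m S^-1.

Definition laguerre_freud (theta : {poly K}) S h : smx K :=
  (dressed_pascal S)^-1 *m smx_diag h *m theta.[(jacobi S)^T].

End Structures.

Section Moments.
Variable K : numFieldType.
Implicit Types (w u : nat -> K).

Definition absolutely_convergent u : Prop := cvgn (series (fun k => `|u k|)).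

Definition moment w (n : nat) : K := limn (series (fun k => k%:R ^+ n * w k)).

Definition moment_matrix w : smx K := fun n m => moment w (n + m).

Definition pearson (theta sigma : {poly K}) w : Prop :=
  forall k : nat, theta.[k.+1%:R] * w k.+1 = sigma.[k%:R] * w k.

End Moments.

(* Main.v *)
(** Write L for the shift, B for the Pascal matrix and G for the moment matrix.
    Shifting the summation index in the moments, the Pearson equation becomes
    theta(L) G = B sigma(L) G B^T, since B encodes the binomial expansion of
    (k + 1)^n. Dressing by S gives theta(J) H = Pi sigma(J) H Pi^T, that is, the
    equality of the two expressions of Psi. Likewise L B = B (L + I) gives
    J Pi = Pi (J + I), and the symmetry of L G gives J H = H J^T; the latter also
    shows that the columns of J, and not only its rows, are finitely supported.
    In Psi H^-1 Psi^T H^-1 one expression is used for Psi and the other one for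
    Psi^T: the factors Pi cancel, up to the shift of J by I. Products of infinite
    matrices are reassociated using that rows, or columns, of suitable factors
    are finitely supported. *)

From HB Require Import structures.
Require Import Defs.
From mathcomp Require Import all_boot all_order all_algebra.
From mathcomp Require Import complex.
From mathcomp Require Import all_classical all_reals all_analysis.
Import Order.TTheory GRing.Theory Num.Theory.
Import numFieldNormedType.Exports.
Local Open Scope classical_set_scope.
Local Open Scope ring_scope.

Set Implicit Arguments.
Unset Strict Implicit.
Unset Printing Implicit Defensive.

(** * Row-finite and column-finite matrices: products and associativity *)

(** Phrased with [\near \oo], so that finitely many rows get a common bound on their supports from
    [filter_forall]. *)
Definition row_finite (K : fieldType) (A : smx K) : Prop :=
  forall n, \forall m \near \oo, A n m = 0.

Definition col_finite (K : fieldType) (A : smx K) : Prop := row_finite A^T%SM.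

Arguments row_finite {K} A%_SM.
Arguments col_finite {K} A%_SM.

Section Product.
Variable K : fieldType.
Local Open Scope smx_scope.
Implicit Types (A B C X : smx K) (h : nat -> K) (p : {poly K}).

Lemma smxP A B : (forall n m, A n m = B n m) -> A = B.
Proof. by move=> AB; apply/funext => n; apply/funext => m. Qed.

Lemma smx_trK A : A^T^T = A.
Proof. by []. Qed.

Lemma row_finite_bound A n : row_finite A ->
  exists N, forall m, (N <= m)%N -> A n m = 0.
Proof. by case/(_ n) => N _ AN; exists N => m /AN. Qed.

Lemma smx_mul_ord N A B n m :
  (forall k, (N <= k)%N -> A n k * B k m = 0) ->
  (A *m B) n m = \sum_(k < N) A n k * B k m.
Proof.
move=> AB0; rewrite /smx_mul (fsbig_ord _ _ (fun k => A n k * B k m)).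
apply/esym/fsbig_widen => //= k [_ /= /negP]; rewrite -leqNgt => Nk.
exact: AB0.
Qed.

Lemma smx_mul_row N A B n m : (forall k, (N <= k)%N -> A n k = 0) ->
  (A *m B) n m = \sum_(k < N) A n k * B k m.
Proof. by move=> A0; apply: smx_mul_ord => k /A0->; rewrite mul0r. Qed.

Lemma smx_tr_mul A B : (A *m B)^T = B^T *m A^T.
Proof.
by apply: smxP => n m; apply: eq_fsbigr => k _; rewrite /smx_tr mulrC.
Qed.

Lemma row_finite_mul A B : row_finite A -> row_finite B -> row_finite (A *m B).
Proof.
move=> rfA rfB n; have [N A0] := row_finite_bound n rfA.
have : \forall m \near \oo, forall k : 'I_N, B k m = 0.
  by apply: filter_forall => k; apply: rfB.
apply: filterS => m B0; rewrite (smx_mul_row _ _ A0) big1 // => k _.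
by rewrite B0 mulr0.
Qed.

Lemma col_finite_mul A B : col_finite A -> col_finite B -> col_finite (A *m B).
Proof. by rewrite /col_finite smx_tr_mul => *; apply: row_finite_mul. Qed.

(** Both sides reduce to one double sum over [k < N] and [l < M], where the order of summation can
    be exchanged. The second hypothesis bears on the products [B k l * C l m], so it covers both
    row-finite [B] and column-finite [C]. *)
Lemma smx_mulA_entry N M A B C n m :
  (forall k, (N <= k)%N -> A n k = 0) ->
  (forall k l, (k < N)%N -> (M <= l)%N -> B k l * C l m = 0) ->
  (A *m (B *m C)) n m = (A *m B *m C) n m.
Proof.
move=> A0 BC0; rewrite (smx_mul_row _ _ A0) (@smx_mul_ord M) => [|l Ml]; last first.
  rewrite (smx_mul_row _ _ A0) mulr_suml big1 // => k _ /=.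
  by rewrite -mulrA BC0 ?mulr0.
transitivity (\sum_(k < N) \sum_(l < M) A n k * B k l * C l m).
  apply: eq_bigr => k _; rewrite (@smx_mul_ord M) => [|l]; last exact: BC0.
  by rewrite mulr_sumr; apply: eq_bigr => l _; rewrite mulrA.
rewrite exchange_big; apply: eq_bigr => l _.
by rewrite (smx_mul_row _ _ A0) mulr_suml.
Qed.

(** The suffixes [rr], [rc] and [cc] tell how finiteness is supplied: by the rows of [A] and [B], by
    the rows of [A] and the columns of [C], or by the columns of [B] and [C]. *)
Lemma smx_mulA_rr A B C : row_finite A -> row_finite B ->
  A *m (B *m C) = A *m B *m C.
Proof.
move=> rfA rfB; apply: smxP => n m; have [N A0] := row_finite_bound n rfA.
have [M _ B0] : \forall l \near \oo, forall k : 'I_N, B k l = 0.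
  by apply: filter_forall => k; apply: rfB.
apply: (smx_mulA_entry A0 (M := M)) => k l kN Ml.
by rewrite (B0 l Ml (Ordinal kN)) mul0r.
Qed.

Lemma smx_mulA_rc A B C : row_finite A -> col_finite C ->
  A *m (B *m C) = A *m B *m C.
Proof.
move=> rfA cfC; apply: smxP => n m; have [N A0] := row_finite_bound n rfA.
have [M C0] := row_finite_bound m cfC.
apply: (smx_mulA_entry A0 (M := M)) => k l kN Ml.
by rewrite [C l m](C0 l Ml) mulr0.
Qed.

Lemma smx_mulA_cc A B C : col_finite B -> col_finite C ->
  A *m (B *m C) = A *m B *m C.
Proof.
by move=> cfB cfC; apply: (can_inj smx_trK); rewrite !smx_tr_mul smx_mulA_rr.
Qed.

Lemma row_finite_add A B : row_finite A -> row_finite B -> row_finite (A + B).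
Proof.
move=> rfA rfB n; apply: filterS2 (rfA n) (rfB n) => m An Bn.
by rewrite -[LHS]/(A n m + B n m) An Bn addr0.
Qed.

Lemma row_finite_opp A : row_finite A -> row_finite (- A).
Proof.
move=> rfA n; apply: filterS (rfA n) => m An.
by rewrite -[LHS]/(- A n m) An oppr0.
Qed.

Lemma row_finite_diag h : row_finite (smx_diag h).
Proof. by move=> n; exists n.+1 => // m /= nm; rewrite /smx_diag ltn_eqF. Qed.

Lemma smx_tr_diag h : (smx_diag h)^T = smx_diag h.
Proof.
by apply: smxP => n m; rewrite /smx_tr /smx_diag eq_sym; case: eqP => // ->.
Qed.

Lemma col_finite_diag h : col_finite (smx_diag h).
Proof. by rewrite /col_finite smx_tr_diag; apply: row_finite_diag. Qed.

Lemma smx_mul_diagl h A n m : (smx_diag h *m A) n m = h n * A n m.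
Proof.
rewrite (@smx_mul_row n.+1) => [|k nk]; last by rewrite /smx_diag ltn_eqF.
rewrite big_ord_recr big1 /= ?add0r /smx_diag ?eqxx // => i _.
by rewrite gtn_eqF ?mul0r.
Qed.

Lemma smx_mul_diagr h A n m : (A *m smx_diag h) n m = A n m * h m.
Proof.
by rewrite -[A *m _]smx_trK smx_tr_mul smx_tr_diag /smx_tr smx_mul_diagl mulrC.
Qed.

Lemma smx_mul1l A : smx_id *m A = A.
Proof. by apply: smxP => n m; rewrite smx_mul_diagl mul1r. Qed.

Lemma smx_mul1r A : A *m smx_id = A.
Proof. by apply: smxP => n m; rewrite smx_mul_diagr mulr1. Qed.

Lemma smx_tr_id : (smx_id : smx K)^T = smx_id.
Proof. exact: smx_tr_diag. Qed.

Lemma smx_mulDr A B C : row_finite A -> A *m (B + C) = (A *m B)%SM + (A *m C)%SM.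
Proof.
move=> rfA; apply: smxP => n m; have [N A0] := row_finite_bound n rfA.
rewrite -[RHS]/(smx_mul A B n m + smx_mul A C n m) !(smx_mul_row _ _ A0) -big_split.
by apply: eq_bigr => k _; exact: mulrDr.
Qed.

Lemma smx_mulNr A B : row_finite A -> A *m (- B) = - (A *m B)%SM.
Proof.
move=> rfA; apply: smxP => n m; have [N A0] := row_finite_bound n rfA.
rewrite -[RHS]/(- smx_mul A B n m) !(smx_mul_row _ _ A0) -sumrN.
by apply: eq_bigr => k _; exact: mulrN.
Qed.

Lemma smx_mulDl A B C : row_finite A -> row_finite B ->
  (A + B) *m C = (A *m C)%SM + (B *m C)%SM.
Proof.
move=> rfA rfB; apply: smxP => n m.
have [N _ AB0] : \forall k \near \oo, A n k = 0 /\ B n k = 0.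
  by apply: filterS2 (rfA n) (rfB n).
rewrite -[RHS]/(smx_mul A C n m + smx_mul B C n m) !(@smx_mul_row N)
  => [|k /AB0[]|k /AB0[]|k /AB0[A0 B0]] //.
  by rewrite -big_split; apply: eq_bigr => k _; exact: mulrDl.
by rewrite -[LHS]/(A n k + B n k) A0 B0 addr0.
Qed.

Lemma smx_mulNl A B : row_finite A -> (- A) *m B = - (A *m B)%SM.
Proof.
move=> rfA; apply: smxP => n m; have [N A0] := row_finite_bound n rfA.
rewrite -[RHS]/(- smx_mul A B n m) !(@smx_mul_row N) => [|k /A0|k /A0 An0] //.
  by rewrite -sumrN; apply: eq_bigr => k _; exact: mulNr.
by rewrite -[LHS]/(- A n k) An0 oppr0.
Qed.

(** * Inverses of diagonal and lower unitriangular matrices *)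

Lemma row_finite_lower A : (forall n m, (n < m)%N -> A n m = 0) -> row_finite A.
Proof. by move=> A0 n; exists n.+1 => // m; apply: A0. Qed.

(** Let [Y] be the inverse picked by [xget]. Then [Y = (X *m A) *m Y = X *m (A *m Y) = X], and this
    reassociation uses only the rows of [X] and [A]: nothing has to be known about the support of
    [Y]. *)
Lemma smx_inv_unique A X : row_finite A -> row_finite X ->
  A *m X = smx_id -> X *m A = smx_id -> A^-1 = X.
Proof.
move=> rfA rfX AX XA.
have [AY _] : [set Y | smx_mul A Y = smx_id /\ smx_mul Y A = smx_id] A^-1.
  by apply: (xgetI A (x := X)).
by rewrite -[A^-1]smx_mul1l -XA -smx_mulA_rr // AY smx_mul1r.
Qed.

Lemma smx_inv_diag h : (forall n, h n != 0) ->
  (smx_diag h)^-1 = smx_diag (fun n => (h n)^-1%R).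
Proof.
move=> h0; apply: smx_inv_unique; try exact: row_finite_diag.
  apply: smxP => n m; rewrite smx_mul_diagl /smx_id /smx_diag.
  by case: eqP => _; rewrite ?mulr0 // mulfV.
apply: smxP => n m; rewrite smx_mul_diagl /smx_id /smx_diag.
by case: eqP => _; rewrite ?mulr0 // mulVf.
Qed.

(* Forward substitution: row [n] of the inverse stabilizes after [n + 1] steps. *)
Lemma lower_unitriangular_rinv A : lower_unitriangular A ->
  exists2 X, lower_unitriangular X & A *m X = smx_id.
Proof.
case=> A1 A0.
pose F X : smx K := fun n m => smx_id n m - \sum_(k < n) A n k * X k m.
pose Y i : smx K := iter i F (fun _ _ => 0).
have YE i n m : Y i.+1 n m = smx_id n m - \sum_(k < n) A n k * Y i k m by [].
have YS i n m : (n < i)%N -> Y i n m = Y n.+1 n m.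
  elim/ltn_ind: n i => n IHn [|i] //; rewrite ltnS !YE => ni.
  congr (_ - _); apply: eq_bigr => k _.
  by rewrite [in RHS](IHn k) // (IHn k) // (leq_trans _ ni).
pose X : smx K := fun n m => Y n.+1 n m.
have XE n m : X n m = smx_id n m - \sum_(k < n) A n k * X k m.
  by rewrite [LHS]YE; congr (_ - _); apply: eq_bigr => k _; rewrite YS.
have X0 n m : (n < m)%N -> X n m = 0.
  elim/ltn_ind: n m => n IHn m nm; rewrite XE /smx_id /smx_diag ltn_eqF //.
  by rewrite big1 ?subr0 // => k _; rewrite IHn ?mulr0 // (ltn_trans _ nm).
exists X; first split=> //.
  move=> n; rewrite XE big1 ?subr0 /smx_id /smx_diag ?eqxx // => k _.
  by rewrite X0 ?mulr0.
apply: smxP => n m; rewrite (@smx_mul_row n.+1) => [|k]; last exact: A0.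
by rewrite big_ord_recr /= A1 mul1r XE addrC subrK.
Qed.

(** A right inverse [X] of [A] is again unitriangular, hence has a right inverse [Z]; then
    [Z = (A *m X) *m Z = A *m (X *m Z) = A], so [X] is a two-sided inverse. *)
Lemma lower_unitriangular_inv A : lower_unitriangular A ->
  [/\ row_finite A^-1, A *m A^-1 = smx_id & A^-1 *m A = smx_id].
Proof.
move=> uA; have [X uX AX] := lower_unitriangular_rinv uA.
have [Z uZ XZ] := lower_unitriangular_rinv uX.
have rf B : lower_unitriangular B -> row_finite B.
  by case=> _; apply: row_finite_lower.
have ZA : Z = A.
  rewrite -[RHS]smx_mul1r -XZ smx_mulA_rr; try exact: rf.
  by rewrite AX smx_mul1l.
have XA : X *m A = smx_id by rewrite -XZ ZA.
by rewrite (smx_inv_unique (rf _ uA) (rf _ uX) AX XA); split=> //; exact: rf.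
Qed.

Lemma row_finite_tr A : col_finite A -> row_finite A^T.
Proof. by []. Qed.

Lemma col_finite_tr A : row_finite A -> col_finite A^T.
Proof. by []. Qed.

End Product.

(** * Polynomials in a matrix, the shift and the Pascal matrix *)

Section Horner.
Variable K : fieldType.
Local Open Scope smx_scope.
Implicit Types (A B C X : smx K) (h : nat -> K) (p : {poly K}).

Lemma row_finite_pow A i : row_finite A -> row_finite (smx_pow A i).
Proof.
by move=> rfA; elim: i => [|i IHi]; [apply: row_finite_diag | apply: row_finite_mul].
Qed.

Lemma row_finite_horner p A : row_finite A -> row_finite p.[A].
Proof.
move=> rfA n.
have : \forall m \near \oo, forall i : 'I_(size p), smx_pow A i n m = 0.
  by apply: filter_forall => i; apply: row_finite_pow.
by apply: filterS => m A0; rewrite /smx_horner big1 // => i _; rewrite A0 mulr0.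
Qed.

Lemma smx_pow_intertwine A B X i : row_finite A -> row_finite B ->
  row_finite X -> A *m X = X *m B -> smx_pow A i *m X = X *m smx_pow B i.
Proof.
move=> rfA rfB rfX AX; elim: i => [|i IHi]; first by rewrite smx_mul1l smx_mul1r.
have rfi C : row_finite C -> row_finite (smx_pow C i) by apply: row_finite_pow.
rewrite /= -/(smx_pow A i) -/(smx_pow B i) -smx_mulA_rr //; last exact: rfi.
by rewrite IHi smx_mulA_rr // AX -smx_mulA_rr.
Qed.

Lemma smx_horner_mull p A X n m : row_finite A ->
  (p.[A] *m X) n m = \sum_(i < size p) p`_i * smx_mul (smx_pow A i) X n m.
Proof.
move=> rfA.
have [N _ A0] : \forall k \near \oo, forall i : 'I_(size p), smx_pow A i n k = 0.
  by apply: filter_forall => i; apply: row_finite_pow.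
rewrite (@smx_mul_row _ N) => [|k /A0 Ak0]; last first.
  by rewrite /smx_horner big1 // => i _; rewrite Ak0 mulr0.
under eq_bigr do rewrite mulr_suml.
rewrite exchange_big; apply: eq_bigr => i _ /=.
rewrite (@smx_mul_row _ N) => [|k /A0 //].
by rewrite mulr_sumr; apply: eq_bigr => k _ /=; rewrite mulrA.
Qed.

Lemma smx_horner_mulr p A X n m : row_finite X ->
  (X *m p.[A]) n m = \sum_(i < size p) p`_i * smx_mul X (smx_pow A i) n m.
Proof.
move=> rfX; have [N X0] := row_finite_bound n rfX.
rewrite (smx_mul_row _ _ X0).
under eq_bigr do rewrite mulr_sumr.
rewrite exchange_big; apply: eq_bigr => i _ /=.
rewrite (smx_mul_row _ _ X0) mulr_sumr; apply: eq_bigr => k _ /=.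
by rewrite mulrCA.
Qed.

Lemma smx_horner_intertwine p A B X : row_finite A -> row_finite B ->
  row_finite X -> A *m X = X *m B -> p.[A] *m X = X *m p.[B].
Proof.
move=> rfA rfB rfX AX; apply: smxP => n m.
rewrite smx_horner_mull // smx_horner_mulr //.
by apply: eq_bigr => i _; rewrite (smx_pow_intertwine i _ _ _ AX).
Qed.

Lemma smx_tr_horner p A : row_finite A -> p.[A]^T = p.[A^T].
Proof.
move=> rfA; apply: smxP => n m; apply: eq_bigr => i _; congr (_ * _).
rewrite -[LHS]/((smx_pow A i)^T n m); congr (_ n m).
elim: (i : nat) => [|j IHj]; first by rewrite /= smx_tr_id.
rewrite /= -/(smx_pow A j) -/(smx_pow A^T j) -IHj -smx_tr_mul.
(* [smx_pow] adds factors on the left, and transposition moves the new one to the right: it remains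
   that [A] commutes with its powers. *)
by rewrite (@smx_pow_intertwine A A A).
Qed.

(** The hypothesis says that the diagonal matrix intertwines [A] and [A^T], so it intertwines
    [p.[A]] and [p.[A^T]]. Column-finiteness of [A] makes [A^T] row-finite. *)
Lemma smx_horner_symm p A h : row_finite A -> col_finite A ->
  A *m smx_diag h = smx_diag h *m A^T ->
  p.[A] *m smx_diag h = smx_diag h *m p.[A]^T.
Proof.
move=> rfA cfA Ah; rewrite smx_tr_horner //.
by apply: smx_horner_intertwine => //; apply: row_finite_diag.
Qed.

Lemma smx_shift_mul A n m : (smx_shift *m A) n m = A n.+1 m.
Proof.
rewrite (@smx_mul_row _ n.+2) => [|k nk]; last by rewrite /smx_shift gtn_eqF.
rewrite big_ord_recr big1 /= ?add0r /smx_shift ?eqxx ?mul1r // => i _.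
by rewrite ltn_eqF ?mul0r.
Qed.

Lemma smx_mul_shift A n m :
  (A *m smx_shift) n m = if m is m'.+1 then A n m' else 0.
Proof.
rewrite (@smx_mul_ord _ m) => [|k mk]; last by rewrite /smx_shift ltn_eqF ?mulr0.
case: m => [|m]; first by rewrite big_ord0.
rewrite big_ord_recr big1 /= ?add0r /smx_shift ?eqxx ?mulr1 // => i _.
by rewrite eqSS gtn_eqF ?mulr0.
Qed.

Lemma row_finite_shift : row_finite (smx_shift : smx K).
Proof. by move=> n; exists n.+2 => // m /= nm; rewrite /smx_shift gtn_eqF. Qed.

Lemma smx_horner_shift_mul p A n m :
  (p.[smx_shift] *m A) n m = \sum_(i < size p) p`_i * A (n + i)%N m.
Proof.
rewrite smx_horner_mull; last exact: row_finite_shift.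
apply: eq_bigr => i _; congr (_ * _); elim: (i : nat) n => [|j IHj] n.
  by rewrite addn0 smx_mul1l.
rewrite /= -/(smx_pow _ j) -smx_mulA_rr; first 1 last.
- exact: row_finite_shift.
- by apply: row_finite_pow; apply: row_finite_shift.
by rewrite smx_shift_mul IHj addSnnS.
Qed.

Lemma col_finite_horner p A : row_finite A -> col_finite A -> col_finite p.[A].
Proof.
by move=> rfA cfA; rewrite /col_finite smx_tr_horner //; apply: row_finite_horner.
Qed.

Lemma lower_unitriangular_pascal : lower_unitriangular (pascal : smx K).
Proof.
by split=> [n|n m nm]; rewrite /pascal ?binn // bin_small.
Qed.

Lemma row_finite_pascal : row_finite (pascal : smx K).
Proof. by case: lower_unitriangular_pascal => _ /row_finite_lower. Qed.

End Horner.

Hint Resolve row_finite_mul col_finite_mul row_finite_add row_finite_opp : smx.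
Hint Resolve row_finite_diag col_finite_diag row_finite_tr col_finite_tr : smx.
Hint Resolve row_finite_horner col_finite_horner : smx.
Hint Resolve row_finite_shift row_finite_pascal : smx.

(** * Moment functionals and Hankel matrices *)

Section Hankel.
Variables (K : fieldType) (c : nat -> K).
Local Open Scope smx_scope.
Implicit Types p q : {poly K}.

(** The linear functional on polynomials with ['X^i] sent to [c i]. Matrix identities for Hankel
    matrices become polynomial identities under it. *)
Definition umbral p : K := \sum_(i < size p) p`_i * c i.

Lemma umbral_widen p N : (size p <= N)%N -> umbral p = \sum_(i < N) p`_i * c i.
Proof.
move=> pN; rewrite /umbral (big_ord_widen N (fun i => p`_i * c i) pN) big_mkcond.
by apply: eq_bigr => i _; case: ltnP => // /(nth_default 0)->; rewrite mul0r.
Qed.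

Lemma umbral_is_scalar : scalar umbral.
Proof.
move=> a p q; pose N := maxn (size p) (size q).
rewrite (@umbral_widen (a *: p + q) N); last first.
  apply: leq_trans (size_polyD _ _) _.
  by rewrite geq_max leq_max (leq_trans (size_scale_leq _ _)) // leq_maxr.
rewrite (@umbral_widen p N) ?leq_maxl // (@umbral_widen q N) ?leq_maxr //.
rewrite mulr_sumr -big_split; apply: eq_bigr => i _ /=.
by rewrite coefD coefZ mulrDl mulrA.
Qed.

HB.instance Definition _ :=
  GRing.isLinear.Build K {poly K} K *%R umbral umbral_is_scalar.

Lemma umbralXn n : umbral 'X^n = c n.
Proof.
rewrite /umbral size_polyXn big_ord_recr big1 /= => [|i _].
  by rewrite coefXn eqxx mul1r add0r.
by rewrite coefXn ltn_eqF ?mul0r.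
Qed.

(** The Gram matrix, in the monomial basis, of the bilinear form taking [p] and [q] to
    [umbral (p * q)]. For [c = moment w] it unfolds to [moment_matrix w]. *)
Definition hankel : smx K := fun n m => c (n + m).

Lemma smx_horner_shift_hankel p n m :
  (p.[smx_shift] *m hankel) n m = umbral (p * 'X^(n + m)).
Proof.
rewrite smx_horner_shift_mul -[p in RHS]coefK poly_def mulr_suml linear_sum.
apply: eq_bigr => i _; rewrite -scalerAl linearZ /= -exprD umbralXn.
by rewrite /hankel addnAC [(_ + i)%N]addnC.
Qed.

Lemma pascal_polyX1 n :
  ('X + 1) ^+ n = \sum_(i < n.+1) pascal n i *: 'X^i :> {poly K}.
Proof.
rewrite addrC exprDn; apply: eq_bigr => i _.
by rewrite expr1n mul1r scaler_nat.
Qed.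

(** Row [n] of the Pascal matrix lists the coefficients of [('X + 1) ^+ n], so the congruence by
    [pascal] replaces the monomials ['X^n] and ['X^m] in the bilinear form by powers of ['X + 1]. *)
Lemma pascal_hankel p n m :
  (pascal *m (p.[smx_shift] *m hankel) *m pascal^T) n m
    = umbral (p * ('X + 1) ^+ (n + m)).
Proof.
have P0 i k : (i.+1 <= k)%N -> pascal i k = 0 :> K.
  by move=> ik; rewrite /pascal bin_small.
rewrite (@smx_mul_ord _ m.+1) => [|k mk]; last first.
  by rewrite /smx_tr P0 ?mulr0.
rewrite exprD !pascal_polyX1 mulr_sumr mulr_sumr linear_sum.
apply: eq_bigr => b _ /=.
rewrite (smx_mul_row _ _ (P0 n)) mulr_suml -!scalerAr linearZ /=.
rewrite mulr_suml mulr_sumr linear_sum mulr_sumr; apply: eq_bigr => a _ /=.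
rewrite smx_horner_shift_hankel -scalerAl -scalerAr linearZ /= -exprD.
by rewrite /smx_tr mulrC.
Qed.

End Hankel.

(** * Absolute convergence of complex series *)

Section ComplexSeries.
Variable R : realType.
Local Notation C := (R[i] : numFieldType).
Implicit Types u : nat -> C.

Lemma normc_ge_Im (z : R[i]) : `|complex.Im z|%:C%C <= `|z|.
Proof.
by case: z => a b; rewrite normc_def lecR -sqrtr_sqr ler_wsqrtr // lerDr sqr_ge0.
Qed.

Lemma cvgn_complex u (a b : R) :
  (fun n => complex.Re (u n)) @ \oo --> a -> (fun n => complex.Im (u n)) @ \oo --> b ->
  u @ \oo --> ((a +i* b)%C : C).
Proof.
move=> /cvgrPdist_lt ua /cvgrPdist_lt ub; apply/cvgrPdist_lt => e e0.
(* A positive complex number is real, so half of its real part can serve as the tolerance for each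
   of the two coordinates. *)
have eE : e = (complex.Re e)%:C%C by rewrite RRe_real // gtr0_real.
have e2 : 0 < complex.Re e / 2 by move: e0; rewrite eE ltcR => e0; rewrite divr_gt0.
apply: filterS2 (ua _ e2) (ub _ e2) => n.
rewrite -(ltcR (`|a - _|)) -(ltcR (`|b - _|)) => ha hb.
have -> : (a +i* b)%C - u n =
    (a - complex.Re (u n))%:C%C + (0 +i* (b - complex.Im (u n)))%C.
  by case: (u n) => x y; simpc.
apply: le_lt_trans (ler_normD _ _) _.
rewrite !normc_def /= expr0n addr0 add0r !sqrtr_sqr.
by rewrite eE [complex.Re e]splitr rmorphD ltrD.
Qed.

Lemma cvgn_Re u (l : C) : u @ \oo --> l ->
  (fun n => complex.Re (u n)) @ \oo --> complex.Re l.
Proof.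
move=> /cvgrPdist_lt ul; apply/cvgrPdist_lt => e e0.
have e0' : 0 < e%:C%C by rewrite ltcR.
apply: filterS (ul _ e0') => n; rewrite -ltcR; apply: le_lt_trans.
by rewrite -raddfB; apply: normc_ge_Re.
Qed.

(** The real and imaginary parts are dominated by the moduli, whose series is in effect real.
    Comparison over the reals gives both limits, which are then assembled. *)
Lemma absolutely_convergent_cvg u :
  absolutely_convergent u -> cvgn (series u).
Proof.
move=> cu; pose v n := complex.Re `|u n|.
have vE n : `|u n| = (v n)%:C%C by rewrite /v RRe_real // normr_real.
have cv : cvgn (series v).
  have -> : series v = (fun n => complex.Re (series (fun k => `|u k|) n)).
    by apply/funext => n; rewrite /series /= raddf_sum.
  by apply: cvgP; apply: cvgn_Re; exact: cu.
have v0 n : 0 <= v n by rewrite -lecR -vE normr_ge0.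
have cRe : cvgn (series (@complex.Re R \o u)).
  apply: normed_cvg; apply: series_le_cvg cv => [n|n|n]; rewrite ?normr_ge0 ?v0 //.
  by rewrite -lecR -vE; apply: normc_ge_Re.
have cIm : cvgn (series (@complex.Im R \o u)).
  apply: normed_cvg; apply: series_le_cvg cv => [n|n|n]; rewrite ?normr_ge0 ?v0 //.
  by rewrite -lecR -vE; apply: normc_ge_Im.
apply: cvgP; apply: (cvgn_complex (a := limn (series (@complex.Re R \o u)))
   (b := limn (series (@complex.Im R \o u)))).
  rewrite (_ : (fun n => _) = series (@complex.Re R \o u)) //.
  by apply/funext => n; rewrite /series /= raddf_sum.
rewrite (_ : (fun n => _) = series (@complex.Im R \o u)) //.
by apply/funext => n; rewrite /series /= raddf_sum.
Qed.

End ComplexSeries.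

(** * Moments of a weight and the Pearson equation *)

Section MomentFunctional.
Variables (K : numFieldType) (w : nat -> K).
Hypothesis w_cvg : forall n : nat, cvgn (series (fun k => k%:R ^+ n * w k)).
Implicit Types p q : {poly K}.

(** Expanding [p] in powers of [k] gives a finite linear combination of moment series. This
    identifies the functional of the moments with summation against the weight. *)
Lemma umbral_moment_cvg p :
  series (fun k => p.[k%:R] * w k) @ \oo --> umbral (moment w) p.
Proof.
have -> : series (fun k => p.[k%:R] * w k) =
    (fun n => \sum_(i < size p) p`_i * series (fun k => k%:R ^+ i * w k) n).
  apply/funext => n; rewrite /series /=.
  under eq_bigr do rewrite horner_coef mulr_suml.
  rewrite exchange_big; apply: eq_bigr => i _ /=.
  by rewrite mulr_sumr; apply: eq_bigr => k _ /=; rewrite mulrA.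
apply: cvg_big => [|i _]; first exact: add_continuous.
by apply: cvgMl_tmp; apply: w_cvg.
Qed.

(* Shifting the summation index loses only the term [k = 0], where [theta] vanishes. *)
Lemma umbral_moment_pearson theta sigma q :
  pearson theta sigma w -> theta.[0] = 0 ->
  umbral (moment w) (theta * q) = umbral (moment w) (sigma * (q \Po ('X + 1))).
Proof.
move=> wP theta0; have /cvg_lim <- // := @umbral_moment_cvg (theta * q).
apply/cvg_lim => //.
rewrite -cvg_shiftS.
rewrite (_ : (fun n => _) = series (fun k => (sigma * (q \Po ('X + 1))).[k%:R] * w k)).
  exact: umbral_moment_cvg.
apply/funext => n; rewrite /series /=.
rewrite big_nat_recl // hornerM theta0 !mul0r add0r.
apply: eq_bigr => k _; rewrite !hornerM horner_comp hornerD hornerX hornerC.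
by rewrite natr1 mulrAC wP mulrAC.
Qed.

(** Entry [(n, m)] is the Pearson identity for the functional, taken at [q = 'X^(n + m)]. *)
Lemma pearson_moment_matrix theta sigma :
  pearson theta sigma w -> theta.[0] = 0 ->
  (theta.[smx_shift] *m moment_matrix w
    = pascal *m (sigma.[smx_shift] *m moment_matrix w) *m pascal^T)%SM.
Proof.
move=> wP theta0; apply: smxP => n m.
rewrite [LHS]smx_horner_shift_hankel [RHS]pascal_hankel.
by rewrite (umbral_moment_pearson _ wP theta0) comp_Xn_poly.
Qed.

End MomentFunctional.


(** * Dressing by [S] and the structure identities *)

(** The computation shared by both identities: [H^-1 *m H] cancels, [A^T] passes through [U] and
    becomes [A'^T], [U *m V] cancels, and [A'^T] passes through [H] and becomes [A']. Every
    reassociation relies on the finite columns of the factors to the right of [X]. *)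
Lemma intertwined_product (K : fieldType) (X A A' U V : smx K) (h : nat -> K) :
  let H := smx_diag h in
  (forall n, h n != 0) -> row_finite A -> col_finite A' -> row_finite A' ->
  col_finite U -> col_finite V -> (U *m V = smx_id ->
  A' *m H = H *m A'^T -> U *m A^T = A'^T *m U ->
  X *m H *m U *m H^-1 *m (H *m A^T *m V) *m H^-1 = X *m A')%SM.
Proof.
move=> H h0 rfA cfA' rfA' cfU cfV UV A'H UA.
have cfH : col_finite H by apply: col_finite_diag.
have HVE : (H^-1)%SM = smx_diag (fun n => (h n)^-1) by apply: smx_inv_diag.
have cfHV : col_finite H^-1 by rewrite HVE; apply: col_finite_diag.
have cfAT : col_finite A^T by apply: col_finite_tr.
have cfA'T : col_finite A'^T by apply: col_finite_tr.
have HHV : (H *m H^-1 = smx_id)%SM.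
  apply: smxP => n m; rewrite HVE smx_mul_diagl /smx_id /smx_diag.
  by case: eqP => _; rewrite ?mulr0 // mulfV.
have HVH : (H^-1 *m H = smx_id)%SM.
  apply: smxP => n m; rewrite HVE smx_mul_diagl /H /smx_id /smx_diag.
  by case: eqP => _; rewrite ?mulr0 // mulVf.
rewrite (smx_mulA_cc _ _ cfV) ?(smx_mulA_cc _ cfH cfAT); auto with smx.
rewrite -(smx_mulA_cc _ cfHV cfH) HVH smx_mul1r.
rewrite -(smx_mulA_cc _ cfU cfAT) UA (smx_mulA_cc _ cfA'T cfU).
rewrite -(smx_mulA_cc _ cfU cfV) UV smx_mul1r.
rewrite -(smx_mulA_cc _ cfH cfA'T) -A'H (smx_mulA_cc _ cfA' cfH).
by rewrite -(smx_mulA_cc _ cfH cfHV) HHV smx_mul1r.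
Qed.

Section Dressing.
Variables (K : fieldType) (G S : smx K) (h : nat -> K).
Hypothesis GS : cholesky G S h.
Local Open Scope smx_scope.
Implicit Types p : {poly K}.

Let H : smx K := smx_diag h.
Let J : smx K := jacobi S.
Let Pi : smx K := dressed_pascal S.

Let uS : lower_unitriangular S. Proof. by case: GS. Qed.
Let h0 : forall n, h n != 0. Proof. by case: GS. Qed.

Let rfS : row_finite S. Proof. by case: uS => _ /row_finite_lower. Qed.
Let rfV : row_finite S^-1. Proof. by case: (lower_unitriangular_inv uS). Qed.
Let SV : S *m S^-1 = smx_id. Proof. by case: (lower_unitriangular_inv uS). Qed.
Let VS : S^-1 *m S = smx_id. Proof. by case: (lower_unitriangular_inv uS). Qed.
Hint Resolve rfS rfV : smx.

Let trVS : S^-1^T *m S^T = smx_id.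
Proof. by rewrite -smx_tr_mul SV smx_tr_id. Qed.

Lemma mul_S_gram : S *m G = H *m S^-1^T.
Proof.
have [_ _ ->] := GS.
rewrite -[S^-1 *m _ *m _]smx_mulA_rr; auto with smx.
by rewrite smx_mulA_rr ?SV ?smx_mul1l; auto with smx.
Qed.

Lemma gram_mul_trS : G *m S^T = S^-1 *m H.
Proof.
have [_ _ ->] := GS; rewrite -smx_mulA_cc; auto with smx.
by rewrite trVS smx_mul1r.
Qed.

Lemma row_finite_jacobi : row_finite J.
Proof. by rewrite /J /jacobi; auto 10 with smx. Qed.

Lemma row_finite_dressed_pascal : row_finite Pi.
Proof. by rewrite /Pi /dressed_pascal; auto 10 with smx. Qed.
Hint Resolve row_finite_jacobi row_finite_dressed_pascal : smx.

(** The inverse is the conjugate of [pascal^-1] by [S]; [conjM] is applied to the two orders of the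
    product. *)
Lemma dressed_pascal_inv :
  [/\ row_finite Pi^-1, Pi *m Pi^-1 = smx_id & Pi^-1 *m Pi = smx_id].
Proof.
have [rfB BC CB] := lower_unitriangular_inv (@lower_unitriangular_pascal K).
have conjM A B : row_finite A -> row_finite B -> A *m B = smx_id ->
    S *m A *m S^-1 *m (S *m B *m S^-1) = smx_id.
  move=> rfA rfB' AB; rewrite smx_mulA_rr; auto 10 with smx.
  rewrite smx_mulA_rr; auto 10 with smx.
  rewrite -[_ *m S^-1 *m S]smx_mulA_rr; auto 10 with smx.
  rewrite VS smx_mul1r -[_ *m A *m B]smx_mulA_rr; auto 10 with smx.
  by rewrite AB smx_mul1r SV.
have PiX := conjM _ _ (row_finite_pascal K) rfB BC.
have XPi := conjM _ _ rfB (row_finite_pascal K) CB.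
rewrite (smx_inv_unique row_finite_dressed_pascal _ PiX XPi); auto 10 with smx.
by split=> //; auto 10 with smx.
Qed.

Lemma jacobi_horner_mul p : p.[J] *m S = S *m p.[smx_shift].
Proof.
apply: smx_horner_intertwine; auto with smx.
by rewrite /J /jacobi -smx_mulA_rr ?VS ?smx_mul1r; auto 10 with smx.
Qed.

(** Since [p.[J] *m S = S *m p.[smx_shift]] and [H] is [S *m G *m S^T], relations between
    polynomials of the shift acting on [G] pass to relations between polynomials of [J] acting on
    [H]. *)
Lemma jacobi_horner_gram p :
  p.[J] *m H = S *m (p.[smx_shift] *m G) *m S^T.
Proof.
rewrite smx_mulA_rr; auto with smx.
rewrite -jacobi_horner_mul -smx_mulA_rc; auto with smx.
rewrite gram_mul_trS -smx_mulA_rr; auto with smx.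
by rewrite (smx_mulA_rr _ rfS rfV) SV smx_mul1l.
Qed.

(** [J *m H] is congruent to [smx_shift *m G] through [S], so it inherits its symmetry. *)
Lemma jacobi_mul_gram : smx_shift *m G = (smx_shift *m G)^T ->
  J *m H = H *m J^T.
Proof.
move=> LG.
have JH : J *m H = S *m (smx_shift *m G) *m S^T.
  have rfL := row_finite_shift K; have cfST : col_finite S^T by auto with smx.
  rewrite /J /jacobi -(smx_mulA_rr _ (B := (S^-1)%SM)); auto with smx.
  rewrite -gram_mul_trS -(smx_mulA_rr _ rfS rfL).
  by rewrite -(smx_mulA_rc _ rfS) // -(smx_mulA_rc _ rfL).
have -> : H *m J^T = (J *m H)^T by rewrite smx_tr_mul smx_tr_diag.
by rewrite JH (smx_tr_mul _ S^T) (smx_tr_mul S) -LG -(smx_mulA_rc _ rfS) //.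
Qed.

Let Pi_S : Pi *m S = S *m pascal.
Proof.
by rewrite /Pi /dressed_pascal -smx_mulA_rr ?VS ?smx_mul1r; auto 10 with smx.
Qed.

Lemma jacobi_mul_dressed_pascal : J *m Pi = Pi *m (J + smx_id).
Proof.
have rfB := row_finite_pascal K; have rfL := row_finite_shift K.
(* Pascal's rule. In column 0 the product [pascal *m smx_shift] vanishes and both remaining
   binomials are 1. *)
have LB : smx_shift *m pascal = (pascal *m smx_shift)%SM + pascal :> smx K.
  apply: smxP => n m.
  rewrite smx_shift_mul -[RHS]/(smx_mul pascal smx_shift n m + pascal n m).
  rewrite smx_mul_shift; case: m => [|m]; rewrite /pascal ?bin0 ?add0r //.
  by rewrite binS natrD addrC.
have VPi : S^-1 *m Pi = pascal *m S^-1.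
  rewrite /Pi /dressed_pascal -smx_mulA_rr; auto with smx.
  by rewrite smx_mulA_rr // VS smx_mul1l.
rewrite smx_mulDr; auto with smx.
rewrite smx_mul1r {1}/J /jacobi -(smx_mulA_rr _ _ rfV); auto with smx.
rewrite VPi -(smx_mulA_rr _ rfS) // (smx_mulA_rr _ rfL) // LB.
rewrite smx_mulDl ?smx_mulDr //; auto with smx.
rewrite /J /jacobi (smx_mulA_rr _ (A := Pi)); auto with smx.
rewrite (smx_mulA_rr _ (A := Pi)); auto with smx.
by rewrite Pi_S /Pi /dressed_pascal -!smx_mulA_rr; auto 10 with smx.
Qed.

Lemma laguerre_freud_identities (theta sigma : {poly K}) :
  smx_shift *m G = (smx_shift *m G)^T ->
  theta.[smx_shift] *m G = pascal *m (sigma.[smx_shift] *m G) *m pascal^T ->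
  let Psi := laguerre_freud theta S h in
  [/\ Psi = sigma.[J] *m H *m Pi^T,
      sigma.[J] *m theta.[J + smx_id] = Psi *m H^-1 *m Psi^T *m H^-1
    & theta.[J] *m sigma.[J - smx_id] = Psi^T *m H^-1 *m Psi *m H^-1].
Proof.
move=> LG thG Psi.
have JH := jacobi_mul_gram LG.
have rfPi := row_finite_dressed_pascal; have rfJ := row_finite_jacobi.
have rfH : row_finite H by apply: row_finite_diag.
have cfH : col_finite H by apply: col_finite_diag.
have cfJ : col_finite J.
  (* Entry [(m, n)] of [JH] reads [J m n * h n = h m * J n m] with [h m] nonzero: a zero in row [m]
     of [J] forces one in column [m]. *)
  move=> m; apply: filterS (row_finite_jacobi m) => n Jmn.
  have := congr1 (fun A => A m n) JH.
  rewrite /= smx_mul_diagr smx_mul_diagl Jmn mul0r => /esym/eqP.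
  by rewrite mulf_eq0 (negPf (h0 m)) => /eqP.
have [rfPiV PiV VPi] := dressed_pascal_inv.
have cf1 : col_finite (smx_id : smx K) by apply: col_finite_diag.
have rf1 : row_finite (smx_id : smx K) by apply: row_finite_diag.
have rfJ1 : row_finite (J + smx_id) by auto with smx.
have cfJ1 : col_finite (J + smx_id) by apply: (row_finite_add cfJ cf1).
have rfJ' : row_finite (J - smx_id) by auto with smx.
have cfJ' : col_finite (J - smx_id).
  by apply: (row_finite_add cfJ (row_finite_opp cf1)).
have J1H : (J + smx_id) *m H = H *m (J + smx_id)^T.
  rewrite smx_mulDl // JH smx_mul1l -[(J + _)^T]/((J^T)%SM + (smx_id^T)%SM).
  by rewrite smx_mulDr ?smx_tr_id ?smx_mul1r //; apply: row_finite_diag.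
have J'H : (J - smx_id) *m H = H *m (J - smx_id)^T.
  rewrite smx_mulDl //; last exact: row_finite_opp.
  rewrite smx_mulNl // JH smx_mul1l.
  rewrite -[(J - _)^T]/((J^T)%SM - (smx_id^T)%SM).
  rewrite smx_mulDr; last exact: row_finite_diag.
  by rewrite smx_mulNr ?smx_tr_id ?smx_mul1r //; apply: row_finite_diag.
have symH p := smx_horner_symm p (row_finite_jacobi) cfJ JH.
have symH1 p := smx_horner_symm p rfJ1 cfJ1 J1H.
have symH' p := smx_horner_symm p rfJ' cfJ' J'H.
have PsiE : Psi = Pi^-1 *m (theta.[J] *m H).
  rewrite /Psi /laguerre_freud -/J -/Pi -/H symH smx_tr_horner //.
  by rewrite smx_mulA_rr.
have Psi1 : Psi = sigma.[J] *m H *m Pi^T.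
  (* From [S *m G = H *m S^-1^T]: the factor [S^-1^T] of [Pi^T] is absorbed, and [G] reappears. *)
  have HPiT : H *m Pi^T = S *m G *m (pascal^T *m S^T).
    rewrite mul_S_gram /Pi /dressed_pascal !smx_tr_mul.
    by rewrite smx_mulA_rc; auto with smx.
  rewrite PsiE jacobi_horner_gram thG.
  have rfsL : row_finite sigma.[smx_shift] by auto with smx.
  have cfY : col_finite (pascal^T *m S^T) by auto with smx.
  (* The dressed Pearson relation [theta.[J] *m H = Pi *m (sigma.[J] *m H *m Pi^T)]; multiplying by
     [Pi^-1] on the left then gives the second expression of [Psi]. *)
  suff -> : S *m (pascal *m (sigma.[smx_shift] *m G) *m pascal^T) *m S^T =
      Pi *m (sigma.[J] *m H *m Pi^T).
    by rewrite smx_mulA_rr // VPi smx_mul1l.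
  rewrite -(smx_mulA_rc _ rfS); auto with smx.
  rewrite -(smx_mulA_cc _ (B := (pascal^T)%SM)); auto with smx.
  rewrite -(smx_mulA_rc _ (row_finite_pascal K)) // -(smx_mulA_rc _ rfsL) //.
  rewrite -(smx_mulA_rr _ (A := (sigma.[J])%SM)); auto with smx.
  rewrite HPiT -(smx_mulA_rc _ rfS) //.
  rewrite (smx_mulA_rr _ (A := (sigma.[J])%SM)); auto with smx.
  rewrite jacobi_horner_mul -(smx_mulA_rr _ rfS) // (smx_mulA_rr _ rfPi rfS).
  rewrite Pi_S -(smx_mulA_rr _ rfS) //.
  exact: row_finite_pascal.
have JPi := jacobi_mul_dressed_pascal.
have JPi' : (J - smx_id) *m Pi = Pi *m J.
  rewrite smx_mulDl //; last exact: row_finite_opp.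
  by rewrite smx_mulNl // JPi smx_mul1l smx_mulDr // smx_mul1r addrK.
(* Conjugating [JPi'] by [Pi^-1]: passing [J] through the inverse lowers it by the identity, whence
   the argument of [sigma] in the last identity. *)
have J'Pi : J *m Pi^-1 = Pi^-1 *m (J - smx_id).
  rewrite -[LHS]smx_mul1l -{1}VPi -smx_mulA_rr // (smx_mulA_rr _ rfPi rfJ) -JPi'.
  by rewrite -(smx_mulA_rr _ rfJ' rfPi) PiV smx_mul1r.
have PsiT : Psi^T = theta.[J] *m H *m Pi^-1^T.
  by rewrite PsiE symH smx_tr_mul smx_tr_mul smx_tr_diag -symH.
have cfPiT : col_finite Pi^T by apply: col_finite_tr.
have cfPiVT : col_finite Pi^-1^T by apply: col_finite_tr.
have PiTK : Pi^T *m Pi^-1^T = smx_id by rewrite -smx_tr_mul VPi smx_tr_id.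
have PiVTK : Pi^-1^T *m Pi^T = smx_id by rewrite -smx_tr_mul PiV smx_tr_id.
have Pi_theta : Pi^T *m theta.[J]^T = theta.[J + smx_id]^T *m Pi^T.
  rewrite -[LHS]smx_tr_mul -[RHS]smx_tr_mul.
  by rewrite (smx_horner_intertwine theta rfJ rfJ1 rfPi).
have Pi_sigma : Pi^-1^T *m sigma.[J]^T = sigma.[J - smx_id]^T *m Pi^-1^T.
  rewrite -[LHS]smx_tr_mul -[RHS]smx_tr_mul.
  by rewrite (smx_horner_intertwine sigma rfJ rfJ' rfPiV).
have rfp p A : row_finite A -> row_finite p.[A] by apply: row_finite_horner.
have cfp p A : row_finite A -> col_finite A -> col_finite p.[A].
  exact: col_finite_horner.
split; first exact: Psi1.
  rewrite PsiT symH Psi1.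
  by rewrite (intertwined_product _ h0 (rfp _ _ rfJ) (cfp _ _ rfJ1 cfJ1)
    (rfp _ _ rfJ1) cfPiT cfPiVT PiTK (symH1 theta) Pi_theta).
(* The same cancellation with [theta] and [sigma] exchanged, and with [Pi^-1^T] and [Pi^T] in the
   roles of [U] and [V]. *)
rewrite PsiT Psi1 (symH sigma).
by rewrite (intertwined_product _ h0 (rfp _ _ rfJ) (cfp _ _ rfJ' cfJ')
  (rfp _ _ rfJ') cfPiVT cfPiT PiVTK (symH' sigma) Pi_sigma).
Qed.

End Dressing.

(** * The identities for a Pearson weight *)

Theorem proposition7 (R : realType) (w : nat -> R[i])
    (theta sigma : {poly R[i]}) (S : smx R[i]) (h : nat -> R[i])
    (moments_cvg : forall n : nat,
       absolutely_convergent (fun k : nat => k%:R ^+ n * w k))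
    (minors_neq0 : forall n : nat, leading_minor (moment_matrix w) n != 0)
    (G_cholesky : cholesky (moment_matrix w) S h)
    (w_pearson : pearson theta sigma w)
    (theta0 : theta.[0] = 0) :
  let H := smx_diag h in
  let J := jacobi S in
  let Pi := dressed_pascal S in
  let Psi := laguerre_freud theta S h in
  [/\ Psi = (sigma.[J] *m H *m Pi^T)%SM,
      (sigma.[J] *m theta.[J + smx_id])%SM
        = (Psi *m H^-1 *m Psi^T *m H^-1)%SM
    & (theta.[J] *m sigma.[J - smx_id])%SM
        = (Psi^T *m H^-1 *m Psi *m H^-1)%SM].
Proof.
apply: (laguerre_freud_identities G_cholesky).
  (* Shifting the rows of the moment matrix leaves a Hankel matrix: both entries are the moment of
     order [n + m + 1]. *)
  apply: smxP => n m; rewrite /smx_tr !smx_shift_mul.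
  by rewrite /moment_matrix addSnnS addnC.
apply: (pearson_moment_matrix _ w_pearson theta0) => n.
exact: absolutely_convergent_cvg.
Qed.
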